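(* Let $K$ be an infinite field, $R = K[x_1,\ldots,x_n]$, and let $I$ be a monomial ideal in $R$. The following are equivalent: 1. $l(a_{\mathbf{x}}^i(I)) < \infty$ for all $i \in \{1,\ldots,n\}$; 2. $I$ is an ideal of Borel type.
   Context: $l(\cdot)$ denotes the length of an $R$-module. For an ideal $I \subseteq R$ put $I_0 = I$ and $I_i = I_{i-1} + (x_{n-i+1})$ for $i \in \{1,\ldots,n\}$, and define, with respect to the sequence $\mathbf{x} = x_n, x_{n-1}, \ldots, x_1$, $$a_{\mathbf{x}}^i(I) = \frac{I_{i-1} : (x_{n-i+1})}{I_{i-1}}, \qquad i = 1,\ldots,n.$$ For $j = 1,\ldots,n$ let $I : (x_1,\ldots,x_j)^\infty = \bigcup_{k \geqslant 0} \left( I : (x_1,\ldots,x_j)^k \right)$ and $I : x_j^\infty = \bigcup_{k \geqslant 0} \left( I : (x_j)^k \right)$. The ideal $I$ is said to be of Borel type if $I : x_j^\infty = I : (x_1,\ldots,x_j)^\infty$ for all $j = 1,\ldots,n$. *)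

(* Defs.v *)
From HB Require Import structures.
From mathcomp Require Import all_boot all_order all_algebra.
From mathcomp Require Import boolp classical_sets cardinality.
From mathcomp Require Import mpoly.

Set Implicit Arguments.
Unset Strict Implicit.
Unset Printing Implicit Defensive.

Import GRing.Theory.

Local Open Scope ring_scope.
Local Open Scope quotient_scope.
Local Open Scope classical_set_scope.

(* A submodule is a bundled boolean predicate ([submodClosed V]). By the
   classical axioms of [boolp] every subset is of this form. *)

Section SubquotientModule.
Context (R : pzRingType) (V : lmodType R).

Definition submodule_type (M : submodClosed V) : predArgType :=
  {v : V | v \in M}.

HB.instance Definition _ M := SubChoice.on (submodule_type M).
HB.instance Definition _ M :=
  [SubChoice_isSubLmodule of submodule_type M by <:].

Context (M N : submodClosed V).

Definition trace_pred : {pred submodule_type M} := fun v => val v \in N.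

Fact trace_pred_submod : submod_closed trace_pred.
Proof.
have [N0 Nlin] := GRing.subsemimod_closed_submod (GRing.subsemimodClosedP N).
split=> [|a u v]; first by rewrite unfold_in raddf0.
by rewrite !unfold_in linearP; apply: Nlin.
Qed.
HB.instance Definition _ :=
  GRing.isSubmodClosed.Build R (submodule_type M) trace_pred trace_pred_submod.

(* The module [M / N], that is M modulo the intersection of M and N; in the
   intended use N is contained in M. *)
Definition subquotient : Type := Quotient.quot trace_pred.

HB.instance Definition _ := GRing.Zmodule.on subquotient.
HB.instance Definition _ := ZmodQuotient.on subquotient.

Definition subquotient_scale (a : R) : subquotient -> subquotient :=
  lift_op1 subquotient ( *:%R a).

Fact subquotient_pi_scale a (v : submodule_type M) :
  subquotient_scale a (\pi_subquotient v) = \pi_subquotient (a *: v).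
Proof.
rewrite /subquotient_scale; unlock; apply/eqP.
rewrite -Quotient.idealrBE -scalerBr.
apply: rpredZ; rewrite Quotient.idealrBE; apply/eqP; exact: reprK.
Qed.

Fact subquotient_scalerA a b v :
  subquotient_scale a (subquotient_scale b v) = subquotient_scale (a * b) v.
Proof. by rewrite -[v]reprK !subquotient_pi_scale scalerA. Qed.

Fact subquotient_scale1r : left_id 1 subquotient_scale.
Proof. by move=> v; rewrite -[v]reprK subquotient_pi_scale scale1r. Qed.

Fact subquotient_scalerDr : right_distributive subquotient_scale +%R.
Proof.
move=> a u v; rewrite -[u]reprK -[v]reprK -raddfD !subquotient_pi_scale.
by rewrite scalerDr raddfD.
Qed.

Fact subquotient_scalerDl v :
  {morph subquotient_scale^~ v : a b / a + b >-> a + b}.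
Proof.
move=> a b; rewrite -[v]reprK !subquotient_pi_scale.
by rewrite scalerDl raddfD.
Qed.

HB.instance Definition _ := GRing.Zmodule_isLmodule.Build R subquotient
  subquotient_scalerA subquotient_scale1r subquotient_scalerDr
  subquotient_scalerDl.

End SubquotientModule.

Section Length.
Context (R : pzRingType) (V : lmodType R).

(* strictly increasing chains C 0 < ... < C k of submodules *)
Definition has_chain (k : nat) : Prop :=
  exists C : nat -> submodClosed V, forall i, (i < k)%N ->
    {subset C i <= C i.+1} /\ ~ {subset C i.+1 <= C i}.

(* l(V) = m: the length is the supremum of the lengths of all chains *)
Definition has_length (m : nat) : Prop :=
  has_chain m /\ forall k, has_chain k -> (k <= m)%N.

(* l(V) < oo *)
Definition finite_length : Prop := exists m, has_length m.

End Length.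

(* [Idealr] of ring_quotient only covers proper ideals, so an ideal is taken
   to be a submodule of the regular module; the unit ideal is allowed. *)
Notation ideal R := (submodClosed (R : comNzRingType)^o).

Section Ideals.
Context (R : comNzRingType).
Implicit Types (S : set R) (I J : ideal R).

(* the smallest ideal containing S *)
Definition ideal_gen_pred S : {pred R^o} := fun f =>
  `[< forall J, (forall g, S g -> g \in J) -> f \in J >].

Fact ideal_gen_submod S : submod_closed (ideal_gen_pred S).
Proof.
split=> [|a f g /asboolP Sf /asboolP Sg]; apply/asboolP => J SJ.
  exact: (@rpred0 R^o J).
by apply: (@rpredD R^o J); [apply: (rpredZ a); apply: Sf | apply: Sg].
Qed.
HB.instance Definition _ S :=
  GRing.isSubmodClosed.Build R R^o (ideal_gen_pred S) (ideal_gen_submod S).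
Definition ideal_gen S : ideal R := ideal_gen_pred S.

Definition ideal_add I J : ideal R :=
  ideal_gen ([set f | f \in I] `|` [set f | f \in J]).

Definition ideal_mul I J : ideal R :=
  ideal_gen [set h | exists f g, [/\ f \in I, g \in J & h = f * g]].

Fixpoint ideal_exp I (k : nat) : ideal R :=
  if k is k'.+1 then ideal_mul I (ideal_exp I k') else ideal_gen [set 1].

Definition colon_pred I J : {pred R^o} := fun f =>
  `[< forall g : R, g \in J -> (f : R) * g \in I >].

Fact colon_submod I J : submod_closed (colon_pred I J).
Proof.
split=> [|a f g /asboolP If /asboolP Ig]; apply/asboolP => h Jh.
  by rewrite mul0r; apply: (@rpred0 R^o I).
rewrite mulrDl; apply: (@rpredD R^o I); last exact: Ig.
by rewrite -[_ *: _]/(a * f) -mulrA; apply: (rpredZ a); apply: If.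
Qed.
HB.instance Definition _ I J :=
  GRing.isSubmodClosed.Build R R^o (colon_pred I J) (colon_submod I J).
Definition colon I J : ideal R := colon_pred I J.

(* I : J^oo, the union of the I : J^k *)
Definition saturation I J : set R :=
  \bigcup_k [set f | f \in colon I (ideal_exp J k)].

(* For a sequence xs = (y_1, ..., y_n), [partial_ideal xs I i] is
   I_i = I + (y_1) + ... + (y_i). *)
Fixpoint partial_ideal (xs : seq R) I (i : nat) : ideal R :=
  if i is i'.+1
  then ideal_add (partial_ideal xs I i') (ideal_gen [set nth 0 xs i'])
  else I.

(* (I_{i-1} : (y_i)) / I_{i-1}, meaningful for 1 <= i <= n; the entry y_i has
   position i - 1 in xs. *)
Definition a_module (xs : seq R) I (i : nat) : lmodType R :=
  subquotient (colon (partial_ideal xs I i.-1) (ideal_gen [set nth 0 xs i.-1]))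
              (partial_ideal xs I i.-1).

End Ideals.

Section Polynomials.
Context (K : fieldType) (n : nat).
Implicit Types (I : ideal {mpoly K[n]}) (j : 'I_n).

Definition monomial_ideal I : Prop :=
  exists S : set 'X_{1..n},
    I =i ideal_gen [set ('X_[m] : {mpoly K[n]}) | m in S].

(* 'X_j stands for x_{j+1}; this is the sequence x_n, ..., x_1. *)
Definition rev_variables : seq {mpoly K[n]} :=
  rev [seq 'X_j | j <- enum 'I_n].

(* (x_1, ..., x_{j+1}) *)
Definition initial_ideal j : ideal {mpoly K[n]} :=
  ideal_gen [set ('X_i : {mpoly K[n]}) | i in [set i : 'I_n | (i <= j)%N]].

Definition borel_type I : Prop :=
  forall j, saturation I (ideal_gen [set 'X_j])
          = saturation I (initial_ideal j).

End Polynomials.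

(* Main.v *)
Require Import Defs.
From HB Require Import structures.
From mathcomp Require Import all_boot all_order all_algebra.
From mathcomp Require Import boolp classical_sets functions cardinality.
From mathcomp Require Import mpoly.
From mathcomp Require Import zify.

Set Implicit Arguments.
Unset Strict Implicit.
Unset Printing Implicit Defensive.

(* A monomial ideal is determined by the upward closed set U of its exponents.
   For monomial ideals N in M, the length of M / N is finite iff finitely many
   monomials lie in M but not in N.  With e_j the exponent of x_j, applied to
   a_x^(n-j+1)(I) this says that the set B_j of exponents m not in U, free of
   x_(j+1), ..., x_n, with m + e_j in U is finite.  On the other hand I is of
   Borel type iff, for i <= j, m + k e_j in U for some k implies m + l e_i in U
   for some l.
   If every B_t is finite, then a line in direction e_t starting far enough out
   in direction e_i cannot enter U, so that x_n, ..., x_j can be stripped one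
   after the other from a monomial in I.  Conversely, by the argument of
   Dickson's lemma an infinite B_j contains, for some m in B_j and some i,
   a multiple of every m + l e_i, which contradicts the Borel condition. *)

(** * Upward closed sets of exponents and their borders *)

Section Exponents.
Import Order.TTheory.
Local Open Scope classical_set_scope.

(** Each new index is a point beyond the previous one at which [u] is minimal on the remaining tail;
    such minima never decrease. *)
Lemma nat_monotone_subsequence (u : nat -> nat) :
  exists phi : nat -> nat, {homo phi : i j / (i < j)%N} /\
    {homo u \o phi : i j / (i <= j)%N}.
Proof.
have min_above N : exists p, (N <= p)%N /\ forall q, (N <= q)%N -> (u p <= u q)%N.
  have exP : exists v, `[< exists2 p, (N <= p)%N & u p = v >].
    by exists (u N); apply/asboolP; exists N.
  case: (ex_minnP exP) => v /asboolP[p Np <-] minv; exists p; split=> // q Nq.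
  by apply: minv; apply/asboolP; exists q.
have [g gP] := choice min_above.
pose phi := fix phi k := if k is k'.+1 then g (phi k').+1 else g 0%N.
have phiS k : (phi k < phi k.+1)%N by case: (gP (phi k).+1).
exists phi; split; first exact: homo_ltn ltn_trans phiS.
apply: homo_leq leq_trans _ => // -[|k] /=; first by apply: (gP 0%N).2.
by apply: (gP (phi k).+1).2; apply: leq_trans (phiS k) (ltnW (phiS k.+1)).
Qed.

Context (n : nat).
Implicit Types (m : 'X_{1..n}) (D U : set 'X_{1..n}) (i j t : 'I_n).

(** Refining the subsequence once per coordinate keeps the coordinates already treated monotone. *)
Lemma mnm_monotone_subsequence (u : nat -> 'X_{1..n}) :
  exists phi : nat -> nat, {homo phi : i j / (i < j)%N} /\
    forall a b, (a <= b)%N -> (u (phi a) <= u (phi b))%MM.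
Proof.
suff [phi [phimono uphi]] : exists phi : nat -> nat, {homo phi : i j / (i < j)%N} /\
    forall c, c \in enum 'I_n -> {homo (fun k => u (phi k) c) : i j / (i <= j)%N}.
  exists phi; split=> // a b ab; apply/mnm_lepP => c.
  by apply: (uphi c) => //; rewrite mem_enum.
elim: (enum _) => [|c r [phi [phimono uphi]]]; first by exists id; split.
have [psi [psimono upsi]] := nat_monotone_subsequence (fun k => u (phi k) c).
exists (phi \o psi); split=> [i j ij|d]; first exact/phimono/psimono.
rewrite inE => /predU1P[->|dr] i j ij /=; first exact: upsi.
apply: uphi dr _ _ _; move: ij; rewrite leq_eqVlt => /predU1P[->//|].
by move=> /psimono/ltnW.
Qed.

Lemma lem_neq_ltn_mdeg m m' : (m <= m')%MM -> m <> m' -> (mdeg m < mdeg m')%N.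
Proof.
move=> le_mm' ne; rewrite -(submK le_mm') mdegD -{1}[mdeg m]add0n ltn_add2r.
rewrite lt0n mdeg_eq0; apply/eqP => d0; apply: ne.
by rewrite -(submK le_mm') d0 add0m.
Qed.

Lemma infinite_mnm_ray D : infinite_set D ->
  exists2 m, D m & exists i, forall l, exists2 m', D m' & (m + U_(i) *+ l <= m')%MM.
Proof.
move=> Dinf; have [u [Du uinj]] : exists u : nat -> 'X_{1..n},
    (forall k, D (u k)) /\ injective u.
  move: Dinf => /infiniteP/card_leP[f].
  exists (fun k => val (f (to_setT k))); split=> [k|k l /val_inj].
    exact: set_valP.
  move/(inj (f := f)) => /(_ (mem_set I) (mem_set I)).
  by move/(congr1 val).
have [phi [phimono uphi]] := mnm_monotone_subsequence u.
apply: contrapT => noray.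
(* If coordinate [i] is unbounded along the monotone sequence, then for every [l] some term
   dominates the first term plus [l e_i], which is a ray. *)
have bnd i : exists l, forall k, (u (phi k) i <= u (phi 0%N) i + l)%N.
  apply: contrapT => unbnd; apply: noray; exists (u (phi 0%N)) => //.
  exists i => l; move/forallNP: unbnd => /(_ l) /existsNP[k /negP].
  rewrite -ltnNge => ltk; exists (u (phi k)) => //.
  apply/mnm_lepP => j; rewrite mnmDE mulmnE mnm1E.
  case: eqVneq => [<-|_]; first by lia.
  by rewrite mul0n addn0; move/mnm_lepP: (uphi 0%N k isT); apply.
have [l lP] := choice bnd.
have degS k : (k <= mdeg (u (phi k)))%N.
  elim: k => // k IH; apply: leq_ltn_trans IH _; apply: lem_neq_ltn_mdeg.
    exact: uphi.
  by move/uinj => e; have := phimono k k.+1 (ltnSn k); rewrite -e ltnn.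
(* Every term has degree at most [mdeg (u (phi 0)) + \sum_i l i], while the k-th has degree at least
   k. *)
have := degS (mdeg (u (phi 0%N)) + \sum_i l i).+1; rewrite leqNgt => /negP; apply.
rewrite !mdegE -big_split /= ltnS; apply: leq_sum => i _; exact: lP.
Qed.

Definition upward_closed U := forall m m', (m <= m')%MM -> U m -> U m'.

(* The exponents of the monomials that form a K-basis of
   [(J : x_j) / J] with [J = I + (x_k | k > j)], where [U] is the set of
   exponents of the monomials of I. *)
Definition border U j : set 'X_{1..n} :=
  [set m | [/\ ~ U m, U (m + U_(j))%MM & forall k : 'I_n, (j < k)%N -> m k = 0%N]].

Lemma lem_addm2l m a b : (a <= b)%MM -> (m + a <= m + b)%MM.
Proof. by move/mnm_lepP=> ab; apply/mnm_lepP => i; rewrite !mnmDE leq_add2l. Qed.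

(* Otherwise, for every [L], going from [m + L e_i] in direction [e_t] one
   leaves the complement of [U] through [border U t]. *)
Lemma border_finite_step U t i m e : upward_closed U -> finite_set (border U t) ->
  (i < t)%N -> (forall k : 'I_n, (t < k)%N -> m k = 0%N) ->
  U (m + U_(t) *+ e)%MM -> exists L, U (m + U_(i) *+ L)%MM.
Proof.
move=> Uup /finite_seqP[s bs] it m0 Ue.
(* No element of [border U t] has an i-th coordinate as large as [L]. *)
pose L := (\max_(x <- s) (x : 'X_{1..n}) i).+1; exists L.
apply: contrapT => notU; suff: U (m + U_(i) *+ L + U_(t) *+ 0)%MM.
  by rewrite mulm0n addm0.
have : U (m + U_(i) *+ L + U_(t) *+ e)%MM.
  by apply: Uup Ue; rewrite Monoid.mulmAC; apply: lem_addr.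
elim: e {Ue} => // e IH Ue; apply: IH; apply: contrapT => notUe.
have : border U t (m + U_(i) *+ L + U_(t) *+ e)%MM.
  split=> // [|k tk]; first by rewrite -addmA -mulmSr.
  by rewrite !mnmDE !mulmnE !mnm1E m0 // -!val_eqE /=; lia.
rewrite bs /= => /(@leq_bigmax_seq _ _ xpredT (fun x : 'X_{1..n} => x i)) => /(_ isT).
rewrite !mnmDE !mulmnE !mnm1E eqxx -/L; rewrite /L; lia.
Qed.

Lemma borders_finiteP U : upward_closed U ->
  (forall j, finite_set (border U j)) <->
  (forall j i m k, (i <= j)%N ->
     U (m + U_(j) *+ k)%MM -> exists l, U (m + U_(i) *+ l)%MM).
Proof.
move=> Uup; split=> [bfin j i m k|sat j].
  rewrite leq_eqVlt => /predU1P[/val_inj <-|ij]; first by exists k.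
  (* Only the coordinates of [m] up to [j + d] may be nonzero; [d = n] is no restriction. *)
  suff down d : forall m, (forall c : 'I_n, (j + d < c)%N -> m c = 0%N) ->
      U (m + U_(j) *+ k)%MM -> exists l, U (m + U_(i) *+ l)%MM.
    by apply: (down n) => c; have := ltn_ord c; lia.
  elim: d => [|d IH] {}m m0 Um.
    apply: border_finite_step (bfin j) ij _ Um => // c.
    by rewrite -{1}[nat_of_ord j]addn0; apply: m0.
  have [jdn|jdn] := leqP n (j + d.+1).
    by apply: IH Um => c; have := ltn_ord c; lia.
  pose t := Ordinal jdn; pose m1 := [multinom if c == t then 0%N else m c | c < n].
  have mE : m = (m1 + U_(t) *+ m t)%MM.
    apply/mnmP => c; rewrite mnmDE mulmnE mnm1E mnmE [t == c]eq_sym.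
    by case: eqVneq => [->|_]; lia.
  (* The last coordinate [t] of [m] is traded for direction [i], so that the induction hypothesis
     applies to [m1 + L e_i]. *)
  have [L UL] : exists L, U (m1 + U_(j) *+ k + U_(i) *+ L)%MM.
    apply: (@border_finite_step U t i _ (m t)) (bfin t) _ _ _ => //=; first by lia.
      move=> c tc; rewrite mnmDE mulmnE mnm1E mnmE.
      have /= := m0 c tc; rewrite -!val_eqE /=; case: eqP => ?; case: eqP => ?; lia.
    by rewrite -addmA (addmC (U_(j) *+ k)%MM) addmA -mE.
  have [||l Ul] := IH (m1 + U_(i) *+ L)%MM; last 1 first.
  - exists (L + l)%N; apply: Uup Ul; rewrite mE.
    apply/mnm_lepP => c; rewrite !mnmDE !mulmnE; lia.
  - move=> c jdc; rewrite mnmDE mulmnE mnm1E mnmE.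
    case: eqVneq => [_|ct]; first by rewrite -val_eqE /=; lia.
    by rewrite m0 -?val_eqE /=; move: ct; rewrite -val_eqE /=; lia.
  - by rewrite Monoid.mulmAC.
apply: contrapT => /infinite_mnm_ray[m [notU Um m0] [i ray]].
(* If [i <= j], the condition forces a border element on the ray into [U]; if [i > j], border
   elements vanish at [i]. *)
have [ij|ji] := leqP i j.
  have [|l Ul] := sat j i m 1%N ij; first by rewrite mulm1n.
  by have [m' [notU' _ _] mm'] := ray l; apply: notU'; apply: Uup mm' Ul.
have [m' [_ _ m'0] /mnm_lepP/(_ i)] := ray 1%N.
by rewrite m'0 // mulm1n mnmDE mnm1E eqxx; lia.
Qed.

End Exponents.

(** * Monomial ideals, their operations and their sets of exponents *)

Section MonomialIdeals.
Import GRing.Theory.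
Local Open Scope classical_set_scope.
Local Open Scope ring_scope.

Lemma submod_closed_bundle (R : pzRingType) (V : lmodType R) (P : {pred V}) :
  submod_closed P -> exists J : submodClosed V, J =i P.
Proof.
move=> Pcl; pose clP := GRing.isSubmodClosed.Build R V P Pcl.
by exists (HB.pack_for (submodClosed V) P clP).
Qed.

Lemma mem_ideal_gen (R : comNzRingType) (S : set R) (g : R) :
  S g -> g \in ideal_gen S.
Proof. by move=> Sg; apply/asboolP => J; apply. Qed.

Lemma ideal_gen_sub (R : comNzRingType) (S : set R) (J : ideal R) (f : R) :
  (forall g, S g -> g \in J) -> f \in ideal_gen S -> f \in J.
Proof. by move=> SJ /asboolP; apply. Qed.

Lemma ideal_mulMl (R : comNzRingType) (J : ideal R) (a f : R) : f \in J -> a * f \in J.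
Proof. exact: (rpredZ a). Qed.

Context (K : fieldType) (n : nat).
Implicit Types (J : ideal {mpoly K[n]}) (U V : set 'X_{1..n}) (A : pred 'I_n).
Implicit Types (f g : {mpoly K[n]}) (m d : 'X_{1..n}) (i j : 'I_n).

(** [J] is the K-span of the monomials with exponents in [U]; operations on such ideals become
    operations on sets of exponents. *)
Definition spanned_by J U :=
  forall f, f \in J <-> (forall m, m \in msupp f -> U m).

Lemma spanned_X J U m : spanned_by J U -> 'X_[m] \in J <-> U m.
Proof.
move=> JU; rewrite JU; split=> [|Um m']; first by apply; rewrite msuppX inE.
by rewrite msuppX inE => /eqP->.
Qed.

Lemma spanned_upward_closed J U : spanned_by J U -> upward_closed U.
Proof.
move=> JU m m' le_mm' Um; apply/(spanned_X m' JU).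
by rewrite -(submK le_mm') mpolyXD; apply/ideal_mulMl/(spanned_X m JU).
Qed.

Lemma spanned_by_ext J U V : (forall m, U m <-> V m) -> spanned_by J U -> spanned_by J V.
Proof. by move=> UV JU f; rewrite JU; split=> fU m /fU/UV. Qed.

Lemma mem_msuppM f g m : m \in msupp (f * g) ->
  exists a b, [/\ a \in msupp f, b \in msupp g & m = (a + b)%MM].
Proof. by move/msuppM_le/allpairsP=> [[a b] [fa gb ->]]; exists a, b. Qed.

Lemma mem_msuppMX f m d : m \in msupp f -> (m + d)%MM \in msupp (f * 'X_[d]).
Proof. by rewrite !mcoeff_msupp addmC mcoeffMX. Qed.

Lemma monomials_sub_ideal J f : (forall m, m \in msupp f -> 'X_[m] \in J) -> f \in J.
Proof.
move=> fJ; rewrite (mpolyE f) big_seq.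
apply: (@rpred_sum {mpoly K[n]}^o J) => m /fJ XJ.
by rewrite -mul_mpolyC; apply: ideal_mulMl.
Qed.

Lemma upward_closed_ideal U : upward_closed U -> exists J, spanned_by J U.
Proof.
move=> Uup; pose P : {pred {mpoly K[n]}^o} :=
  fun f => `[< forall m, m \in msupp (f : {mpoly K[n]}) -> U m >].
have [|J JP] := @submod_closed_bundle _ {mpoly K[n]}^o P.
  split=> [|a f g /asboolP fU /asboolP gU]; apply/asboolP => m.
    by rewrite msupp0.
  move/msuppD_le; rewrite mem_cat => /orP[|/gU//].
  by move/mem_msuppM => [x [y [_ /fU Uy ->]]]; apply: Uup Uy; apply: lem_addl.
by exists J => f; rewrite JP; split=> [/asboolP|? ]; last exact/asboolP.
Qed.

(** The span of [U] is itself an ideal containing [S], which bounds the generated ideal from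
    above. *)
Lemma ideal_gen_spanned (S : set {mpoly K[n]}) U : upward_closed U ->
  (forall g m, S g -> m \in msupp g -> U m) ->
  (forall m, U m -> 'X_[m] \in ideal_gen S) -> spanned_by (ideal_gen S) U.
Proof.
move=> Uup SU US f; split=> [fS|fU]; last first.
  by apply: monomials_sub_ideal => m /fU/US.
have [J JU] := upward_closed_ideal Uup.
by apply/JU; apply: ideal_gen_sub fS => g Sg; apply/JU => m; apply: SU.
Qed.

Lemma monomial_ideal_spanned J : monomial_ideal J -> exists U, spanned_by J U.
Proof.
move=> [S JS]; exists [set m | exists2 s, S s & (s <= m)%MM].
suff gen : spanned_by (ideal_gen [set ('X_[m] : {mpoly K[n]}) | m in S])
    [set m | exists2 s, S s & (s <= m)%MM] by move=> f; rewrite JS; apply: gen.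
apply: ideal_gen_spanned => [m m' mm' [s Ss sm]|g m [s Ss <-]|m [s Ss /submK <-]].
- by exists s => //; apply: lepm_trans mm'.
- by rewrite msuppX inE => /eqP->; exists s => //; apply: lepm_refl.
- by rewrite mpolyXD; apply/ideal_mulMl/mem_ideal_gen; exists s.
Qed.

(** A general set [A] of variables covers both the ideal of a single variable and that of an initial
    segment. *)
Lemma ideal_gen_vars_spanned A :
  spanned_by (ideal_gen [set ('X_i : {mpoly K[n]}) | i in [set i | A i]])
    [set m | exists2 i, A i & (0 < m i)%N].
Proof.
apply: ideal_gen_spanned => [m m' /mnm_lepP mm' [i Ai mi]|g m [i Ai <-]|m [i Ai mi]].
- by exists i => //; apply: leq_trans (mm' i).
- by rewrite msuppX inE => /eqP->; exists i => //; rewrite mnm1E eqxx.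
- have /submK <- : (U_(i) <= m)%MM by rewrite lep1mP -lt0n.
  by rewrite mpolyXD; apply/ideal_mulMl/mem_ideal_gen; exists i.
Qed.

Lemma ideal_gen_var_spanned i :
  spanned_by (ideal_gen [set 'X_i]) [set m | (0 < m i)%N].
Proof.
have := ideal_gen_vars_spanned (pred1 i).
have -> : [set i0 | pred1 i i0] = [set i].
  by apply/seteqP; split=> x /= => [/eqP|->].
rewrite image_set1; apply: spanned_by_ext => m.
by split=> [[_ /eqP->]|mi] //; exists i => /=.
Qed.

Lemma ideal_add_spanned J J' U V : spanned_by J U -> spanned_by J' V ->
  spanned_by (ideal_add J J') (U `|` V).
Proof.
move=> JU JV; apply: ideal_gen_spanned.
- move=> m m' mm' [Um|Vm]; [left|right].
    by apply: (spanned_upward_closed JU) mm' Um.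
  by apply: (spanned_upward_closed JV) mm' Vm.
- by move=> g m [/JU gU|/JV gV]; [move/gU; left|move/gV; right].
- move=> m [Um|Vm]; apply: mem_ideal_gen; [left|right].
    exact/(spanned_X m JU).
  exact/(spanned_X m JV).
Qed.

Lemma ideal_mul_spanned J J' U V : spanned_by J U -> spanned_by J' V ->
  spanned_by (ideal_mul J J') [set m | exists a b, [/\ U a, V b & m = (a + b)%MM]].
Proof.
move=> JU JV; apply: ideal_gen_spanned.
- move=> m m' mm' [a [b [Ua Vb mE]]]; exists (m' - m + a)%MM, b; split=> //.
    by apply: (spanned_upward_closed JU) Ua; apply: lem_addl.
  by rewrite -addmA -mE submK.
- move=> g m [f [h [/JU fU /JV hV ->]]] /mem_msuppM[a [b [/fU Ua /hV Vb mE]]].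
  by exists a, b.
- move=> m [a [b [Ua Vb ->]]]; apply: mem_ideal_gen.
  exists 'X_[a], 'X_[b]; split; [exact/(spanned_X a JU)|exact/(spanned_X b JV)|].
  exact: mpolyXD.
Qed.

(** Multiplying by a monomial shifts the support without cancellation, so the colon can be tested on
    monomials. *)
Lemma colon_spanned J J' U V : spanned_by J U -> spanned_by J' V ->
  spanned_by (colon J J') [set m | forall d, V d -> U (m + d)%MM].
Proof.
move=> JU JV f; split=> [/asboolP fJ m fm d Vd|fU].
  have /JU : f * 'X_[d] \in J by apply: fJ; apply/(spanned_X d JV).
  by apply; apply: mem_msuppMX.
apply/asboolP => g /JV gV; apply/JU => m /mem_msuppM[a [b [/fU aU /gV Vb ->]]].
exact: aU.
Qed.

Lemma ideal_exp_vars_spanned A k :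
  spanned_by
    (ideal_exp (ideal_gen [set ('X_i : {mpoly K[n]}) | i in [set i | A i]]) k)
    [set m | (k <= \sum_(i | A i) m i)%N].
Proof.
elim: k => [|k IH] /=.
  apply: ideal_gen_spanned => // m _.
  by rewrite -['X_[m]]mulr1; apply/ideal_mulMl/mem_ideal_gen.
apply: spanned_by_ext (ideal_mul_spanned (ideal_gen_vars_spanned A) IH) => m.
split=> /= [[a [b [[i Ai ai] kb ->]]]|km].
  under eq_bigr do rewrite mnmDE.
  by rewrite big_split /= -add1n leq_add // (bigD1 i) //= addn_gt0 ai.
have [i /andP[Ai mi]] : exists i, A i && (0 < m i)%N.
  apply/existsP; apply: contraTT km; rewrite negb_exists => /forallP mA.
  rewrite big1 // => i Ai; apply/eqP; have := mA i.
  by rewrite Ai /= lt0n negbK.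
have Uim : (U_(i) <= m)%MM by rewrite lep1mP -lt0n.
exists U_(i)%MM, (m - U_(i))%MM; split; last by rewrite addmC submK.
  by exists i => //; rewrite mnm1E eqxx.
have rest : (\sum_(c | A c && (c != i)) (m - U_(i))%MM c =
    \sum_(c | A c && (c != i)) m c)%N.
  by apply: eq_bigr => c /andP[_ ci]; rewrite mnmBE mnm1E eq_sym (negbTE ci) subn0.
rewrite /= -ltnS; move: km => /=; rewrite !(bigD1 i Ai) /= rest mnmBE mnm1E eqxx => km.
by apply: leq_trans km _; rewrite -addSn -subSn // subSS subn0.
Qed.

(** A high power of the ideal of the variables in [A] lies in the ideal generated by prescribed
    powers of them, so saturation is checked one variable at a time. *)
Lemma saturation_varsP J U A f : spanned_by J U ->
  saturation J (ideal_gen [set ('X_i : {mpoly K[n]}) | i in [set i | A i]]) f <->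
  forall m i, m \in msupp f -> A i -> exists l, U (m + U_(i) *+ l)%MM.
Proof.
move=> JU; have Uup := spanned_upward_closed JU.
have colk k := colon_spanned JU (ideal_exp_vars_spanned A k).
split=> [[k _ /colk fU] m i mf Ai|fU].
  exists k; apply: (fU m mf); rewrite /= (bigD1 i) //= mulmnE mnm1E eqxx; lia.
have /choice[l lP] (mi : 'X_{1..n} * 'I_n) : exists l, mi.1 \in msupp f -> A mi.2 ->
    U (mi.1 + U_(mi.2) *+ l)%MM.
  have [[mf Ai]|h] := pselect (mi.1 \in msupp f /\ A mi.2).
    by have [l Ul] := fU _ _ mf Ai; exists l.
  by exists 0%N => mf Ai; case: h.
(* Pigeonhole: if the degree of [d] in [A] exceeds the sum of the [l (m, i)], some [d i] is at least
   [l (m, i)]. The maximum serves all monomials of [f] at once. *)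
exists (\max_(m <- msupp f) \sum_(i | A i) l (m, i)).+1 => //.
apply/colk => m mf d /= dA.
have [i /andP[Ai ldi]] : exists i, A i && (l (m, i) <= d i)%N.
  apply/existsP; apply: contraTT dA; rewrite negb_exists -leqNgt => /forallP ldA.
  apply: leq_trans (_ : _ <= \sum_(i | A i) l (m, i))%N _.
    by apply: leq_sum => i Ai; have := ldA i; rewrite Ai /= -ltnNge => /ltnW.
  exact: (@leq_bigmax_seq _ _ xpredT (fun m => \sum_(i | A i) l (m, i))%N).
apply: Uup (lP (m, i) mf Ai); apply: lem_addm2l.
apply/mnm_lepP => c; rewrite mulmnE mnm1E.
by case: eqVneq => [<-|_]; rewrite ?mul1n ?mul0n.
Qed.

(** Single monomials yield the exponent condition. Conversely, it gives one inclusion of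
    saturations; the other is the case [i = j]. *)
Lemma borel_typeP J U : spanned_by J U ->
  borel_type J <->
  (forall j i m k, (i <= j)%N ->
     U (m + U_(j) *+ k)%MM -> exists l, U (m + U_(i) *+ l)%MM).
Proof.
move=> JU.
have satj j f : saturation J (ideal_gen [set 'X_j]) f <->
    forall m, m \in msupp f -> exists l, U (m + U_(j) *+ l)%MM.
  have -> : [set 'X_j] = [set ('X_i : {mpoly K[n]}) | i in [set i | pred1 j i]].
    rewrite -(@image_set1 _ _ (fun i => 'X_i)); congr image.
    by apply/seteqP; split=> x /= => [->|/eqP].
  rewrite (saturation_varsP _ f JU).
  by split=> [fU m mf|fU m i mf /eqP->]; [apply: fU => //=|apply: fU].
have satle j f := saturation_varsP (fun i => (i <= j)%N) f JU.
split=> [Bor j i m k ij Uk|comb j].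
  have : saturation J (initial_ideal K j) 'X_[m].
    by rewrite -Bor; apply/satj => m'; rewrite msuppX inE => /eqP->; exists k.
  by move/satle; apply; rewrite ?msuppX ?inE.
apply/seteqP; split=> f.
  by move/satj => fU; apply/satle => m i /fU[k Uk] ij; apply: comb Uk.
by move/satle => fU; apply/satj => m mf; apply: fU.
Qed.

Lemma nth_rev_variables j : nth 0 (rev_variables K n) (n - j.+1) = 'X_j.
Proof.
have jn := ltn_ord j; rewrite nth_rev; rewrite size_map size_enum_ord; last by lia.
have -> : (n - (n - j.+1).+1)%N = j by lia.
by rewrite (nth_map j) ?size_enum_ord // nth_ord_enum.
Qed.

Lemma partial_ideal_spanned J U (i : nat) : (i <= n)%N -> spanned_by J U ->
  spanned_by (partial_ideal (rev_variables K n) J i)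
    [set m | U m \/ exists2 k : 'I_n, (n - i <= k)%N & (0 < m k)%N].
Proof.
move=> le_in JU; elim: i le_in => [|i IH] lt_in /=.
  apply: spanned_by_ext JU => m; split=> [Um|[//|[k]]]; first by left.
  by have := ltn_ord k; lia.
have jn : (n - i.+1 < n)%N by lia.
have -> : nth 0 (rev_variables K n) i = 'X_(Ordinal jn).
  by rewrite -nth_rev_variables /=; congr nth; lia.
apply: spanned_by_ext (ideal_add_spanned (IH (ltnW lt_in)) (ideal_gen_var_spanned _)).
move=> m; split=> [[[Um|[k ik mk]]|mj]|[Um|[k ik mk]]].
- by left.
- by right; exists k => //; lia.
- by right; exists (Ordinal jn).
- by left; left.
have [ek|nk] := eqVneq k (Ordinal jn); first by right; rewrite /= -ek.
by left; right; exists k => //; move: nk; rewrite -val_eqE /=; lia.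
Qed.

End MonomialIdeals.

(** * Submodules and chains in a subquotient *)

Section Length.
Import Order.TTheory GRing.Theory.
Local Open Scope classical_set_scope.
Local Open Scope ring_scope.
Local Open Scope quotient_scope.

(* [submodClosed] is stated over semirings, hence does not provide [rpredN]. *)
Lemma submod_opp (R : pzRingType) (V : lmodType R) (L : submodClosed V) (v : V) :
  v \in L -> - v \in L.
Proof. by move=> Lv; rewrite -scaleN1r rpredZ. Qed.

Lemma submod_addl (R : pzRingType) (V : lmodType R) (L : submodClosed V) (d v : V) :
  d \in L -> (d + v \in L) = (v \in L).
Proof.
move=> Ld; apply/idP/idP => [Ldv|]; last exact: rpredD.
by rewrite -(addKr d v) rpredD // submod_opp.
Qed.

Lemma chain_subset (R : pzRingType) (V : lmodType R) (C : nat -> submodClosed V) k :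
  (forall i, (i < k)%N -> {subset C i <= C i.+1}) ->
  forall i j, (i <= j <= k)%N -> {subset C i <= C j}.
Proof.
move=> sub i; elim=> [|j IH] /andP[]; first by rewrite leqn0 => /eqP-> _ v.
rewrite leq_eqVlt => /predU1P[-> _ v //|ij jk] v Cv.
by apply: (sub j jk); apply: (IH _ v Cv); rewrite -ltnS ij ltnW.
Qed.

Lemma finite_lengthP (R : pzRingType) (V : lmodType R) :
  finite_length V <-> exists b, forall k, has_chain V k -> (k <= b)%N.
Proof.
split=> [[m [_ mmax]]|[b bP]]; first by exists m.
have ex0 : exists k, `[< has_chain V k >].
  have [|J _] := @submod_closed_bundle R V predT; first by split=> [|? ? ?].
  by exists 0%N; apply/asboolP; exists (fun=> J).
have [k /asboolP|m /asboolP mch mmax] := ex_maxnP ex0 (m := b); first exact: bP.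
by exists m; split=> // k ch; apply/mmax/asboolP.
Qed.

Section Subquotient.
Context (R : pzRingType) (V : lmodType R) (M N : submodClosed V).
Implicit Types (v : submodule_type M).

Lemma submodule_valZ (a : R) v : val (a *: v) = a *: val v.
Proof. by rewrite -[a *: v]addr0 linearP raddf0 addr0. Qed.

Lemma subquotient_pi_eq0 v : (\pi_(subquotient M N) v == 0) = (val v \in N).
Proof. by rewrite -(raddf0 \pi_(subquotient M N)) -Quotient.idealrBE subr0. Qed.

Lemma subquotient_scale_pi (a : R) v :
  a *: \pi_(subquotient M N) v = \pi_(subquotient M N) (a *: v).
Proof. exact: subquotient_pi_scale. Qed.

(** [C] is the image of the intersection of [L] and [M], tested on representatives; their choice is
    immaterial because [L] contains [N]. *)
Lemma subquotient_submodule (L : submodClosed V) : {subset N <= L} ->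
  exists C : submodClosed (subquotient M N),
    forall v, (\pi_(subquotient M N) v \in C) = (val v \in L).
Proof.
move=> NL; pose P : {pred subquotient M N} := fun x => val (repr x) \in L.
have Ppi v : (\pi_(subquotient M N) v \in P) = (val v \in L).
  have : val (repr (\pi_(subquotient M N) v) - v) \in N.
    by rewrite -subquotient_pi_eq0 raddfB /= reprK subrr.
  move/NL; rewrite raddfB => d.
  by rewrite unfold_in -[val (repr _)](subrK (val v)) submod_addl.
have [|C CP] := @submod_closed_bundle _ _ P.
  split=> [|a x y].
    by rewrite -(raddf0 \pi_(subquotient M N)) Ppi raddf0 rpred0.
  rewrite -(reprK x) -(reprK y) subquotient_scale_pi -raddfD !Ppi.
  move=> xL yL; rewrite linearP; apply: rpredD yL; exact: rpredZ.
by exists C => v; rewrite CP Ppi.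
Qed.

(** Strictness is witnessed inside [M], since the quotient sees only the part of [L i] in [M]. *)
Lemma subquotient_has_chain k (L : nat -> submodClosed V) :
  (forall i, {subset N <= L i}) ->
  (forall i, (i < k)%N -> {subset L i <= L i.+1} /\
     exists2 v, v \in M & (v \in L i.+1) && (v \notin L i)) ->
  has_chain (subquotient M N) k.
Proof.
move=> NL Lchain.
have [C CP] := choice (fun i => subquotient_submodule (NL i)).
exists C => i /Lchain[Lsub [v vM /andP[vL1 vL]]]; split=> [x|].
  by rewrite -(reprK x) !CP; apply: Lsub.
move/(_ (\pi_(subquotient M N) (Sub v vM : submodule_type M))).
by rewrite !CP /= vL1 (negbTE vL) => /(_ isT).
Qed.

End Subquotient.

(** * Length of a quotient of monomial ideals *)

Context (K : fieldType) (n : nat) (M N : ideal {mpoly K[n]}) (U V : set 'X_{1..n}).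
Context (MU : spanned_by M U) (NV : spanned_by N V).

(** The monomials are adjoined from the largest down: the monomial order refines divisibility, so
    those already adjoined never generate the next one. *)
Lemma has_chain_sorted_monomials (s : seq 'X_{1..n}) :
  sorted <%O s -> (forall m, m \in s -> (U `\` V) m) ->
  has_chain (subquotient M N) (size s).
Proof.
move=> s_sorted sD.
(* The exponents in [V] or at or above one of the [i] largest entries of [s]. *)
pose W i := V `|` [set m | exists2 a, (size s - i <= a < size s)%N &
  (nth 0%MM s a <= m)%O].
have Wup i : upward_closed (W i).
  move=> m m' mm' [Vm|[a ai am]]; [left|right].
    exact: (spanned_upward_closed NV) mm' Vm.
  by exists a => //; apply: le_trans am (lem_leo mm').
have [L LW] := choice (fun i => upward_closed_ideal K (Wup i)).
apply: (subquotient_has_chain (L := L)) => [i f /NV fV|i lt_is].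
  by apply/LW => m /fV; left.
split=> [f /LW fW|].
  apply/LW => m /fW[Vm|[a ai am]]; first by left.
  by right; exists a => //; lia.
have ltb : (size s - i.+1 < size s)%N by lia.
have [Ub nVb] := sD _ (mem_nth 0%MM ltb).
exists 'X_[nth 0%MM s (size s - i.+1)]; first exact/(spanned_X _ MU).
apply/andP; split.
  by apply/(spanned_X _ (LW i.+1)); right; exists (size s - i.+1)%N => //; lia.
apply/negP => /(spanned_X _ (LW i))[//|[a /andP[le_a lt_a]]].
by rewrite lt_geF // (sorted_ltn_nth lt_trans) ?inE // subnSK.
Qed.

(* Lifts of elements witnessing the strict inclusions of a chain are linearly
   independent over K modulo N. *)
Lemma has_chain_size_le (s : seq 'X_{1..n}) k :
  (forall m, (U `\` V) m -> m \in s) -> has_chain (subquotient M N) k ->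
  (k <= size s)%N.
Proof.
move=> Ds [C Cchain]; rewrite leqNgt; apply/negP => lt_sk.
have /choice[x xP] (i : 'I_k) :
    exists y : subquotient M N, (y \in C i.+1) && (y \notin C i).
  have [_] := Cchain i (ltn_ord i).
  apply: contra_notP => /forallNP xC y yC1.
  by apply: contrapT => /negP yC; apply: (xC y); rewrite yC1.
have Csub := chain_subset (fun i ik => (Cchain i ik).1).
pose w i : {mpoly K[n]} := val (repr (x i)).
pose A : 'M[K]_(k, size s) := \matrix_(i, j) (w i)@_(nth 0%MM s j).
(* [A] has more rows than columns, so some nonzero combination of the lifts has zero coefficients at
   all exponents in [s]. *)
have : kermx A != 0.
  rewrite kermx_eq0 /row_free; apply: contraTneq lt_sk => <-.
  by rewrite -leqNgt rank_leq_col.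
case/rowV0Pn => u /sub_kermxP uA u0.
pose y : submodule_type M := \sum_i (u 0 i)%:MP *: repr (x i).
have valy : val y = \sum_i (u 0 i)%:MP * w i :> {mpoly K[n]}.
  rewrite raddf_sum; apply: eq_bigr => i _.
  exact: (submodule_valZ (u 0 i)%:MP (repr (x i))).
have yN : val y \in N.
  apply/NV => m ym; apply: contrapT => nVm.
  have Um : U m by apply: (MU (val y)).1 ym; apply: valP.
  move: ym; rewrite mcoeff_msupp valy raddf_sum => /eqP; apply.
  have sm := Ds m (conj Um nVm); rewrite -index_mem in sm.
  move/rowP: uA => /(_ (Ordinal sm)); rewrite !mxE => uA0.
  rewrite -[RHS]uA0; apply: eq_bigr => i _.
  by rewrite !mxE /= nth_index -?index_mem // mcoeffCM.
have sum0 : \sum_i (u 0 i)%:MP *: x i = 0.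
  transitivity (\pi_(subquotient M N) y).
    rewrite raddf_sum; apply: eq_bigr => i _.
    rewrite -{1}[x i]reprK.
    exact: (@subquotient_scale_pi _ _ M N (u 0 i)%:MP (repr (x i))).
  by apply/eqP; rewrite subquotient_pi_eq0.
have [i0 ui0] : exists i, u 0 i != 0 by apply/rV0Pn.
(* For the last nonzero coefficient, the relation expresses [x i] through earlier [x j], all of
   which lie in [C i]. *)
case: (@arg_maxnP _ i0 (fun i => u 0 i != 0) val ui0) => i ui imax.
have /andP[_ /negP] := xP i; apply.
have -> : x i = (u 0 i)^-1%:MP *: ((u 0 i)%:MP *: x i).
  by rewrite scalerA -mpolyCM mulVf // scale1r.
apply: rpredZ; move: sum0; rewrite (bigD1 i) //= => /eqP; rewrite addr_eq0 => /eqP->.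
apply: submod_opp; apply: rpred_sum => j ji.
have [uj0|uj] := eqVneq (u 0 j) 0; first by rewrite uj0 mpolyC0 scale0r rpred0.
apply: rpredZ; have /andP[xj _] := xP j; apply: Csub xj.
have /= := imax j uj; move: ji; rewrite -val_eqE /=; have := ltn_ord i; lia.
Qed.

Lemma subquotient_finite_length :
  finite_length (subquotient M N) <-> finite_set (U `\` V).
Proof.
rewrite finite_lengthP; split=> [[b bP]|/finite_seqP[s sE]].
  (* An infinite difference has finite subsets of every size, hence chains of every length. *)
  apply: contrapT => /(infinite_set_fset b.+1)[B BD leB].
  have : has_chain (subquotient M N) (size (sort <=%O (finmap.enum_fset B))).
    apply: has_chain_sorted_monomials; first by rewrite sort_lt_sorted finmap.fset_uniq.
    by move=> m; rewrite mem_sort => mB; apply: BD.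
  by move/bP; rewrite size_sort leqNgt leB.
by exists (size s) => k; apply: has_chain_size_le => m; rewrite sE.
Qed.

End Length.

(** * The modules of the sequence and the equivalence *)

Section Main.
Local Open Scope classical_set_scope.

(** With variables counted from 0, the index [n - j] belongs to ['X_j], and the ideal divided out is
    [I] plus the variables of index above [j]; the exponents in the colon but not in this ideal form
    the border. *)
Lemma a_module_finite_length (K : fieldType) (n : nat) (I : ideal {mpoly K[n]})
    (U : set 'X_{1..n}) (j : 'I_n) : spanned_by I U ->
  finite_length (a_module (rev_variables K n) I (n - j)) <->
  finite_set (border U j).
Proof.
move=> IU; have jn := ltn_ord j; have Uup := spanned_upward_closed IU.
have predE : (n - j).-1 = (n - j.+1)%N by lia.
rewrite /a_module predE nth_rev_variables.
have NV := partial_ideal_spanned (leq_subr j.+1 n) IU; rewrite subKn // in NV.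
rewrite (subquotient_finite_length (colon_spanned NV (ideal_gen_var_spanned j)) NV).
rewrite -(_ : border U j = _ `\` _) //; apply/seteqP; split=> m /=.
  move=> [nUm Um m0]; split=> [d dj|[//|[k /m0->//]]].
  by left; apply: Uup Um; apply: lem_addm2l; rewrite lep1mP -lt0n.
move=> [colon_m notV]; have m0 (k : 'I_n) : (j < k)%N -> m k = 0%N.
  move=> jk; apply/eqP; rewrite -leqn0 leqNgt; apply/negP => mk.
  by apply: notV; right; exists k.
split=> //; first by move=> Um; apply: notV; left.
have [|//|[k jk]] := colon_m U_(j)%MM; first by rewrite mnm1E eqxx.
rewrite mnmDE mnm1E m0 //; case: eqVneq => // jk'.
by move: jk; rewrite jk' ltnn.
Qed.

End Main.

Theorem proposition2p14 (K : fieldType) (n : nat) (I : ideal {mpoly K[n]})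
    (Kinf : infinite_set [set: K]) (Imon : monomial_ideal I) :
  (forall i : nat, (1 <= i <= n)%N ->
     finite_length (a_module (rev_variables K n) I i)) <->
  borel_type I.
Proof.
have [U IU] := monomial_ideal_spanned Imon.
rewrite (borel_typeP IU) -(borders_finiteP (spanned_upward_closed IU)).
split=> [fin j|fin i i1n].
  by apply/(a_module_finite_length j IU)/fin; have := ltn_ord j; lia.
have jn : (n - i < n)%N by lia.
have -> : i = (n - Ordinal jn)%N by rewrite /=; lia.
exact/(a_module_finite_length (Ordinal jn) IU).
Qed.
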